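(* If $a=\{a_j\}_{j\ge1}$ is any positive, summable, decreasing sequence, then $\dim_A E\ge\dim_A C_a$ for any complementary set $E\in\mathcal{C}_a$.
   Context: Decreasing means $a_j\ge a_{j+1}$ for all $j$. Let $L=\sum_j a_j$. The family $\mathcal{C}_a$ of complementary sets of $a$ consists of the closed subsets $E$ of $[0,L]$ of the form $E=[0,L]\setminus\bigcup_{j=1}^\infty U_j$, where $\{U_j\}$ is a disjoint family of open intervals contained in $[0,L]$ with the length of $U_j$ equal to $a_j$ for each $j$. The associated Cantor set $C_a\in\mathcal{C}_a$ is constructed as follows. From $I=[0,L]$ remove an open interval of length $a_1$, leaving two closed intervals $I^1_1$ and $I^1_2$ (left to right). Having constructed the closed intervals $I^k_1,\dots,I^k_{2^k}$ of step $k$ (left to right), remove from each $I^k_j$ an open interval of length $a_{2^k+j-1}$, leaving the closed intervals $I^{k+1}_{2j-1}$ and $I^{k+1}_{2j}$. The positions are uniquely determined by requiring that the length of each $I^k_j$ equal the sum of the lengths of all the open intervals subsequently removed from it. Then $C_a=\bigcap_{k\ge1}\bigcup_{j=1}^{2^k}I^k_j$. For non-empty $F\subset\mathbb{R}$, $N_r(F)$ denotes the minimum number of closed balls of radius $r$ needed to cover $F$, and $B(x,R)$ is the closed ball of radius $R$ centred at $x$. The Assouad dimension is $$\dim_A F=\inf\Bigl\{\alpha:\ \exists\, c,\rho>0 \text{ such that } \sup_{x\in F}N_r(B(x,R)\cap F)\le c\left(\tfrac{R}{r}\right)^{\alpha}\text{ for all }0<r<R<\rho\Bigr\}.$$ 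*)

(* Defs.v *)
From mathcomp Require Import all_boot all_order all_algebra.
From mathcomp Require Import all_classical all_reals all_analysis.

Set Implicit Arguments.
Unset Strict Implicit.
Unset Printing Implicit Defensive.

Import Order.TTheory GRing.Theory Num.Theory.
Import numFieldNormedType.Exports.

Local Open Scope classical_set_scope.
Local Open Scope ring_scope.

(* Indices start at 0: a sequence a_1, a_2, ... is given as a : nat -> R with
   a_(j+1) = a j, and the intervals I^k_1, ..., I^k_(2^k) of step k are numbered
   j = 0, ..., 2^k - 1. *)

Definition total_length (R : realType) (a : nat -> R) : R :=
  limn (series a).

Definition complementary_set (R : realType) (a : nat -> R) (E : set R) : Prop :=
  closed E /\
  exists U : nat -> set R,
    [/\ forall j, exists x y : R, U j = `]x, y[%classic /\ y - x = a j,
        forall j, U j `<=` `[0, total_length a],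
        trivIset setT U
      & E = `[0, total_length a] `\` \bigcup_j U j].

(* The gap removed from interval j of step k is a_(2^k + (j+1) - 1), 1-based. *)
Definition cantor_gap (R : realType) (a : nat -> R) (k j : nat) : R :=
  a (2 ^ k + j).-1.

(* The sum of all gaps removed from interval j of step k: i steps later, the
   intervals inside it are those numbered j * 2^i + l with l < 2^i. *)
Definition cantor_length (R : realType) (a : nat -> R) (k j : nat) : R :=
  limn (series (fun i => \sum_(l < 2 ^ i) cantor_gap a (k + i) (j * 2 ^ i + l))).

(* Interval j of step k+1 lies in interval j./2 of step k: it is the left part
   if j is even, and the right part, beyond its sibling j.-1 and the gap, if j
   is odd. *)
Fixpoint cantor_left (R : realType) (a : nat -> R) (k j : nat) : R :=
  if k is k'.+1 then
    cantor_left a k' j./2 +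
    (if odd j then cantor_length a k'.+1 j.-1 + cantor_gap a k' j./2 else 0)
  else 0.

Definition cantor_interval (R : realType) (a : nat -> R) (k j : nat) : set R :=
  `[cantor_left a k j, cantor_left a k j + cantor_length a k j].

Definition cantor_set (R : realType) (a : nat -> R) : set R :=
  \bigcap_(k in [set k | (1 <= k)%N])
    \bigcup_(j in [set j | (j < 2 ^ k)%N]) cantor_interval a k j.

(* Ball centres are arbitrary points of R; the value is +oo if no finite family
   of balls covers F. *)
Definition covering_number (R : realType) (r : R) (F : set R) : \bar R :=
  ereal_inf [set (n%:R)%:E | n in
    [set n : nat | exists c : 'I_n -> R,
       F `<=` \bigcup_(i in [set: 'I_n]) closed_ball (c i) r]].

Definition assouad_dim (R : realType) (F : set R) : \bar R :=
  ereal_inf [set alpha%:E | alpha in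
    [set alpha : R | exists c rho : R, [/\ 0 < c, 0 < rho &
       forall r s : R, 0 < r -> r < s -> s < rho ->
         (ereal_sup [set covering_number r (closed_ball x s `&` F) | x in F]
            <= (c * (s / r) `^ alpha)%:E)%E]]].

(* Main.v *)
Require Import Defs.
From mathcomp Require Import all_boot all_order all_algebra.
From mathcomp Require Import all_classical all_reals all_analysis.
From mathcomp Require Import ring lra zify.

(** Let t_n be the sum of all gaps but the n largest, and let s_k be
    t_(2^k - 1) / 2^k, the mean length of the 2^k intervals of step k of the
    Cantor set.  The proof compares both sets with the single sequence s_k.

    For the Cantor set, the gaps decrease, so an interval of step k + 1 is no
    longer than any interval of step k; averaging, the intervals of step k all
    have length between s_(k+1) and s_(k-1) ([mean_le_cantor_length],
    [cantor_length_le_mean]).  If s_(u+2) <= s < s_(u+1), a ball of radius s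
    centred on the Cantor set thus meets at most three intervals of step u, and
    if s_(w+2) <= r < s_(w+1), each of them is covered by its 2^(w+3-u)
    subintervals of step w + 3, which have length at most r.  So about 2^(w-u)
    balls of radius r suffice ([cantor_set_local_cover]).

    For an arbitrary complementary set E, about 2^(n-k) balls of radius s_n / 2
    are necessary near some point, at scale s_k.  Globally, N balls of radius r
    that cover E swallow all but at most N of the gaps, so their total length
    2 r N is at least t_N ([gap_tail_le_of_cover]); hence 2^n balls are
    necessary when r = s_n / 2.  On the other hand, removing the 2^k - 1 largest gaps leaves
    2^k intervals of total length 2^k s_k, so E splits into 2^(k+1) pieces of
    diameter at most s_k ([ball_coverable_of_local]), and one of them needs a
    proportion 2^-(k+1) of the balls.  An exponent alpha admissible for E in the
    definition of the Assouad dimension therefore satisfies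
    2^(n-k) <= D (s_k / s_n)^alpha ([assouad_exponent_mean_tail]), which is
    exactly what makes alpha admissible for the Cantor set: take k = u + 2 and
    n = w + 1, so that s_k <= s and r < s_n, hence s_k / s_n <= s / r.  Passing to
    powers uses alpha >= 0, which the same bound gives when n grows
    ([assouad_exponent_ge0]). *)

Set Implicit Arguments.
Unset Strict Implicit.
Unset Printing Implicit Defensive.

Import Order.TTheory GRing.Theory Num.Theory.
Import numFieldNormedType.Exports.

Local Open Scope classical_set_scope.
Local Open Scope ring_scope.

(** * Tails of a decreasing series *)

Section Tails.
Context {R : realType} (a : nat -> R).
Hypothesis a_pos : forall j, 0 < a j.
Hypothesis a_summable : cvgn (series a).
Hypothesis a_decr : forall j, a j.+1 <= a j.

Definition gap_tail (n : nat) : R := total_length a - \sum_(j < n) a j.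

(** This is the mean length of the intervals of step k of the Cantor set: the gaps
    removed from step k on are those left after the first 2^k - 1. *)
Definition mean_tail (k : nat) : R := gap_tail (2 ^ k).-1 / 2 ^+ k.

Lemma gap_antitone i j : (i <= j)%N -> a j <= a i.
Proof.
elim: j => [|j IH]; first by rewrite leqn0 => /eqP->.
rewrite leq_eqVlt => /orP[/eqP->//|]; rewrite ltnS => /IH; exact: le_trans.
Qed.

Lemma partial_sum_le_total n : \sum_(j < n) a j <= total_length a.
Proof.
have := nondecreasing_cvgn_le _ a_summable n.
rewrite /series /= big_mkord; apply.
by apply: nondecreasing_series => k _ _; exact: ltW.
Qed.

Lemma gap_tailS n : gap_tail n = a n + gap_tail n.+1.
Proof. by rewrite /gap_tail big_ord_recr /=; ring. Qed.

Lemma gap_tail_gt0 n : 0 < gap_tail n.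
Proof.
by rewrite gap_tailS ltr_pwDl ?a_pos// /gap_tail subr_ge0 partial_sum_le_total.
Qed.

Lemma gap_tail_antitone m n : (m <= n)%N -> gap_tail n <= gap_tail m.
Proof.
elim: n => [|n IH]; first by rewrite leqn0 => /eqP->.
rewrite leq_eqVlt => /orP[/eqP->//|]; rewrite ltnS => /IH; apply: le_trans.
by rewrite (gap_tailS n) ler_wpDl// ltW.
Qed.

Lemma total_gt0 : 0 < total_length a.
Proof. by have := gap_tail_gt0 0; rewrite /gap_tail big_ord0 subr0. Qed.

Lemma mean_tail_gt0 k : 0 < mean_tail k.
Proof. by rewrite divr_gt0 ?gap_tail_gt0// exprn_gt0. Qed.

(** The denominator doubles at each step, and the tail can only decrease. *)
Lemma mean_tail_half k : mean_tail k.+1 <= mean_tail k / 2.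
Proof.
rewrite /mean_tail exprS invfM mulrA [leRHS]mulrAC -!mulrA.
rewrite ler_pM2r ?mulr_gt0 ?invr_gt0 ?exprn_gt0// gap_tail_antitone//.
by rewrite expnS; lia.
Qed.

Lemma mean_tail_antitone k n : (k <= n)%N -> mean_tail n <= mean_tail k.
Proof.
elim: n => [|n IH]; first by rewrite leqn0 => /eqP->.
rewrite leq_eqVlt => /orP[/eqP->//|]; rewrite ltnS => /IH; apply: le_trans.
apply: (le_trans (mean_tail_half n)).
by have := mean_tail_gt0 n; lra.
Qed.

Lemma mean_tail_small (e : R) : 0 < e -> exists n, mean_tail n <= e.
Proof.
move=> e0; set n := (Num.trunc (total_length a / e)).+1.
exists n; rewrite ler_pdivrMr ?exprn_gt0//.
have tl : gap_tail (2 ^ n).-1 <= total_length a.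
  apply: le_trans (gap_tail_antitone (leq0n _)) _.
  by rewrite /gap_tail big_ord0 subr0.
apply: le_trans tl _; rewrite mulrC -ler_pdivrMr//.
have /andP[_ /ltW h] := truncn_itv (ltW (divr_gt0 total_gt0 e0)).
by apply: le_trans h _; rewrite -natrX ler_nat ltnW// ltn_expl.
Qed.

(** Locates a radius between two consecutive means; the shift of the indices
    leaves room for a step u whose intervals are all longer than r. *)
Lemma mean_tail_bracket (r : R) : 0 < r -> r < mean_tail 1 ->
  exists u, mean_tail u.+2 <= r < mean_tail u.+1.
Proof.
move=> r0 r1.
have ex : exists u, mean_tail u.+2 <= r.
  have [n hn] := mean_tail_small r0; exists n.
  by apply: le_trans hn; apply: mean_tail_antitone; lia.
case: (ex_minnP ex) => -[|u] hu hmin; first by exists 0%N; rewrite hu.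
exists u.+1; rewrite hu /= ltNge; apply/negP => /hmin; lia.
Qed.

(** The m-th selected index is at least m, and the terms decrease. *)
Lemma selected_sum_le_initial (P : pred nat) M :
  \sum_(0 <= j < M | P j) a j
    <= \sum_(0 <= j < size [seq j <- iota 0 M | P j]) a j.
Proof.
elim: M => [|M IH]; first by rewrite /= !big_geq.
rewrite big_mkcond big_nat_recr// -big_mkcond.
have -> : iota 0 M.+1 = iota 0 M ++ [:: M] by rewrite -addn1 iotaD.
rewrite filter_cat size_cat /=.
case: (P M) => /=; last by rewrite addr0 addn0.
rewrite addn1 big_nat_recr//= lerD// gap_antitone//.
by rewrite size_filter; apply: leq_trans (count_size _ _) _; rewrite size_iota.
Qed.

End Tails.

(** * Lengths of disjoint intervals *)

(** Finite additivity of Lebesgue measure on the selected open intervals, and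
    subadditivity on the closed intervals that cover them. *)
Lemma disjoint_intervals_length_le (R : realType) (l a : nat -> R)
    (P : pred nat) M (c d : nat -> R) N :
  (forall j, 0 < a j) -> (forall i, (i < N)%N -> c i <= d i) ->
  (forall i j, i <> j -> l i + a i <= l j \/ l j + a j <= l i) ->
  (forall j x, (j < M)%N -> P j -> l j < x < l j + a j ->
     exists2 i, (i < N)%N & c i <= x <= d i) ->
  \sum_(0 <= j < M | P j) a j <= \sum_(0 <= i < N) (d i - c i).
Proof.
move=> a0 cd dis cov.
pose F j : set R := if P j then `]l j, (l j + a j)[%classic else set0.
pose B i : set R := `[c i, d i]%classic.
have mF j : measurable (F j).
  by rewrite /F; case: (P j) => //; exact: measurable_itv.
have mB j : measurable (B j) by exact: measurable_itv.
have tF : trivIset setT F.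
  apply/trivIsetP => i j _ _ /eqP ij; rewrite -subset0 => x [].
  rewrite /F; case: (P i) => //; case: (P j) => //=.
  rewrite !in_itv/= => /andP[h1 h2] /andP[h3 h4].
  by case: (dis _ _ ij); lra.
have mA : measurable (\big[setU/set0]_(i < M) F i).
  by apply: bigsetU_measurable => i _; exact: mF.
have := @content_subadditive _ R _ (@lebesgue_measure R)
  (\big[setU/set0]_(i < M) F i) B N.
move=> /(_ (fun k _ => mB k) mA).
have -> := measure_bigsetU (@lebesgue_measure R) mF tF M.
have -> : (\sum_(i < M) lebesgue_measure (F i) =
  (\sum_(0 <= j < M | P j) a j)%:E)%E.
  rewrite [in RHS]big_mkcond [in RHS]big_mkord -sumEFin; apply: eq_bigr => i _.
  rewrite /F; case: (P i); last by rewrite measure0.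
  rewrite lebesgue_measure_itv/= lte_fin ltrDl a0 -EFinB; congr (_%:E); ring.
have -> : (\sum_(i < N) lebesgue_measure (B i) =
  (\sum_(0 <= i < N) (d i - c i))%:E)%E.
  rewrite big_mkord -sumEFin; apply: eq_bigr => i _.
  rewrite /B lebesgue_measure_itv/= lte_fin.
  case: ltP => [_|h]; first by rewrite -EFinB.
  by have := cd _ (ltn_ord i) => h'; congr (_%:E); lra.
rewrite lee_fin; apply => x.
rewrite -!bigcup_mkord => -[j /= jM]; rewrite /F; case Pj : (P j) => //=.
rewrite in_itv/= => /(cov _ _ jM Pj)[i iN hi]; exists i => //=.
Qed.

(** * Coverings by balls and admissible exponents *)

(** Indexing the centres by all natural numbers, of which the first n count,
    lets coverings be enlarged and concatenated without casts. *)
Definition ball_coverable (R : realType) (r : R) (n : nat) (F : set R) : Prop :=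
  exists c : nat -> R, forall x, F x -> exists2 i, (i < n)%N & `|c i - x| <= r.

Lemma covering_number_le (R : realType) (r : R) n (F : set R) :
  0 < r -> ball_coverable r n F -> (covering_number r F <= n%:R%:E)%E.
Proof.
move=> r0 [c hc]; apply: ereal_inf_lbound; exists n => //.
exists (fun i => c i) => x /hc[i ilt hi]; exists (Ordinal ilt) => //=.
by rewrite closed_ballE.
Qed.

Lemma coverable_of_covering_number_lt (R : realType) (r M : R) (F : set R) :
  0 < r -> (covering_number r F < M%:E)%E ->
  exists2 n, n%:R < M & ball_coverable r n F.
Proof.
move=> r0 /ereal_inf_lt[_ [n [c hc] <-]]; rewrite lte_fin => nM.
exists n => //; exists (fun i => if insub i is Some o then c o else 0) => x Fx.
have [i _] := hc x Fx; rewrite closed_ballE// => hi.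
exists (val i); first exact: ltn_ord.
by rewrite valK.
Qed.

Lemma ball_coverable_sub (R : realType) (r : R) m n (F G : set R) :
  (m <= n)%N -> G `<=` F -> ball_coverable r m F -> ball_coverable r n G.
Proof.
move=> mn GF [c hc]; exists c => x /GF /hc[i im hi].
by exists i => //; exact: leq_trans mn.
Qed.

(** Ball i of the covering of fibre m is numbered m * q + i. *)
Lemma ball_coverable_classes (R : realType) (r : R) p q (F : set R)
    (f : R -> nat) :
  (forall x, F x -> (f x < p)%N) ->
  (forall m, (m < p)%N -> ball_coverable r q (F `&` [set x | f x = m])) ->
  ball_coverable r (p * q) F.
Proof.
move=> fp hF.
have [g hg] : {g : nat -> nat -> R & forall m, (m < p)%N ->
    forall x, F x -> f x = m -> exists2 i, (i < q)%N & `|g m i - x| <= r}.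
  apply: (@choice _ _ (fun m gm => (m < p)%N ->
    forall x, F x -> f x = m -> exists2 i, (i < q)%N & `|gm i - x| <= r)) => m.
  have [mp|] := ltnP m p; last by exists (fun=> 0).
  by have [c hc] := hF m mp; exists c => _ x Fx fx; exact: hc.
exists (fun i => g (i %/ q)%N (i %% q)%N) => x Fx.
have [i iq hi] := hg _ (fp x Fx) x Fx erefl.
have q0 : (0 < q)%N by apply: leq_trans iq.
exists (f x * q + i)%N.
  have := leq_mul (fp x Fx) (leqnn q); rewrite mulSn; lia.
by rewrite divnMDl// divn_small// addn0 modnMDl modn_small.
Qed.

Definition assouad_exponent (R : realType) (F : set R) (alpha c rho : R) : Prop :=
  [/\ 0 < c, 0 < rho & forall r s : R, 0 < r -> r < s -> s < rho ->
     (ereal_sup [set covering_number r (closed_ball x s `&` F) | x in F]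
        <= (c * (s / r) `^ alpha)%:E)%E].

(** * Complementary sets *)

(** The left ends of the gaps carry all the information on a complementary set;
    here disjoint gaps are separated on the line, one lying left of the other. *)
Record gap_layout (R : realType) (a l : nat -> R) (E : set R) : Prop :=
  GapLayout {
  layout_ge0 : forall j, 0 <= l j;
  layout_le : forall j, l j + a j <= total_length a;
  layout_disjoint : forall i j, i <> j -> l i + a i <= l j \/ l j + a j <= l i;
  layout_mem : forall x,
    E x <-> 0 <= x <= total_length a /\ forall j, ~ l j < x < l j + a j }.

Lemma open_intervals_meet (R : realFieldType) (u v w z : R) :
  u < v -> u < z -> w < v -> w < z -> exists2 x, u < x < v & w < x < z.
Proof.
move=> uv uz wv wz; have [uw|wu] := leP u w; have [vz|zv] := leP v z.
- by exists ((w + v) / 2); lra.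
- by exists ((w + z) / 2); lra.
- by exists ((u + v) / 2); lra.
- by exists ((u + z) / 2); lra.
Qed.

(** Since gaps are nonempty and open, containment in [0, L] and disjointness
    become inequalities between end points. *)
Lemma complementary_set_layout (R : realType) (a : nat -> R) (E : set R) :
  (forall j, 0 < a j) -> complementary_set a E -> exists l, gap_layout a l E.
Proof.
move=> a0 [_ [U [Uitv Uin Udis ->]]].
have [l hl] : {l : nat -> R & forall j, U j = `]l j, (l j + a j)[%classic}.
  apply: (@choice _ _ (fun j lj => U j = `]lj, (lj + a j)[%classic)) => j.
  have [x [y [-> yx]]] := Uitv j; exists x; rewrite (_ : x + a j = y)//.
  by rewrite -yx; ring.
have UE j x : U j x <-> l j < x < l j + a j by rewrite hl /= in_itv.
have in0T j x : l j < x < l j + a j -> 0 <= x <= total_length a.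
  by move=> /UE /Uin /=; rewrite in_itv.
exists l; split.
- move=> j; rewrite leNgt; apply/negP => lj0; have aj := a0 j.
  have [||||x /in0T xT] := @open_intervals_meet _ (l j) (l j + a j) (l j - 1) 0;
    lra.
- move=> j; rewrite leNgt; apply/negP => ljT; have aj := a0 j.
  have [||||x /in0T xT] := @open_intervals_meet _ (l j) (l j + a j)
    (total_length a) (l j + a j + 1); lra.
- move=> i j ij; apply: contrapT => /not_orP[/negP h1 /negP h2].
  have ai := a0 i; have aj := a0 j; move: h1 h2; rewrite -!ltNge => h1 h2.
  have [||||x xi xj] := @open_intervals_meet _ (l i) (l i + a i)
    (l j) (l j + a j);
    rewrite ?ltrDl//.
  by apply: ij; apply: (Udis i j I I); exists x; split; apply/UE.
- move=> x; rewrite /= in_itv/=; split=> -[x0T h]; split=> //.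
    by move=> j /UE Ux; apply: h; exists j.
  by move=> -[j _ /UE]; exact: h.
Qed.

Section GapLayout.
Context {R : realType} (a l : nat -> R) (E : set R).
Hypothesis a_pos : forall j, 0 < a j.
Hypothesis a_summable : cvgn (series a).
Hypothesis a_decr : forall j, a j.+1 <= a j.
Hypothesis lay : gap_layout a l E.

Lemma gap_right_end_mem j : E (l j + a j).
Proof.
apply/(layout_mem lay); split.
  by rewrite (layout_le lay) andbT addr_ge0 ?(layout_ge0 lay)// ltW.
move=> i h; have [ij|/eqP ij] := eqVneq i j; first by move: h; rewrite ij; lra.
by case: (layout_disjoint lay ij); have := a_pos j; lra.
Qed.

(** Choose for every gap a ball that contains its right end point, which belongs
    to E.  Of two gaps with the same ball, the right-hand one lies between two
    points of that ball, so it is inside the ball by convexity.  Hence at most N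
    gaps are not swallowed by the covering, and these have total length at most
    that of the N largest gaps; the swallowed ones have total length at most
    2 r N. *)
Lemma gap_tail_le_of_cover r N : 0 < r -> ball_coverable r N E ->
  gap_tail a N <= 2 * r * N%:R.
Proof.
move=> r0 [c hc].
have [i hi] : {i : nat -> nat & forall j,
    (i j < N)%N /\ `|c (i j) - (l j + a j)| <= r}.
  apply: (@choice _ _ (fun j m => (m < N)%N /\ `|c m - (l j + a j)| <= r)) => j.
  by have [m mN hm] := hc _ (gap_right_end_mem j); exists m.
pose P j := `[< forall p, l j < p < l j + a j ->
  exists2 m, (m < N)%N & c m - r <= p <= c m + r >].
have inj : {in [pred j | ~~ P j] &, injective i}.
  suff wlg u v : ~~ P v -> i u = i v -> u <> v -> l u + a u <= l v -> False.
    move=> u v; rewrite !inE => Pu Pv iuv; apply: contrapT => uv.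
    case: (layout_disjoint lay uv) => h; first exact: (wlg u v).
    by apply: (wlg v u) => // vu; exact: uv.
  move=> /asboolP + iuv uv luv; apply => p hp; exists (i v).
    by case: (hi v).
  have [_] := hi v; have [_] := hi u; rewrite iuv !ler_norml; lra.
have few M : (size [seq j <- iota 0 M | ~~ P j] <= N)%N.
  rewrite -(size_map i) -[leqRHS](size_iota 0); apply: uniq_leq_size.
    rewrite map_inj_in_uniq ?filter_uniq ?iota_uniq// => u v.
    by rewrite !mem_filter => /andP[+ _] /andP[+ _]; exact: inj.
  move=> _ /mapP[j _ ->]; rewrite mem_iota add0n leq0n /=.
  by case: (hi j).
have bound M : \sum_(j < M) a j <= 2 * r * N%:R + \sum_(j < N) a j.
  rewrite -(big_mkord xpredT) (bigID P) /=; apply: lerD.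
    have := @disjoint_intervals_length_le R l a P M
      (fun m => c m - r) (fun m => c m + r) N a_pos.
    move=> /(_ _ (layout_disjoint lay)) h.
    apply: le_trans (h _ _) _ => [m _|j x _ /asboolP|]; [lra|exact|].
    rewrite (eq_bigr (fun=> 2 * r)); last by move=> ? _; ring.
    by rewrite sumr_const_nat subn0 mulr_natr.
  apply: le_trans (selected_sum_le_initial a_decr _ _) _.
  rewrite -(big_mkord xpredT) [leRHS](big_cat_nat (leq0n _) (few M)) /= lerDl.
  by apply: sumr_ge0 => j _; exact: ltW.
rewrite /gap_tail lerBlDr; apply: limr_le => //.
by apply: nearW => M; rewrite /series /= big_mkord.
Qed.

(** Along E, this is the length outside the first K gaps in
    units of d, plus one for each of these gaps passed: crossing such a gap
    trades its length for a unit jump.  On E it is nondecreasing, and an increase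
    by less than one rules out any of the K gaps and bounds the distance
    by d. *)
Definition gap_clock (K : nat) (d x : R) : R :=
  x / d + \sum_(0 <= j < K | l j + a j <= x) (1 - a j / d).

(** The integer m counts the gaps passed between x and y, and t is the remaining
    length in units of d. *)
Lemma gap_clock_diff K (d x y : R) : 0 < d -> E x -> E y -> x < y ->
  exists m : nat, exists2 t, 0 <= t &
    gap_clock K d y - gap_clock K d x = m%:R + t /\ (m = 0%N -> t = (y - x) / d).
Proof.
move=> d0 Ex Ey xy.
pose Q j := x < l j + a j <= y.
exists (\sum_(0 <= j < K | Q j) 1)%N.
exists ((y - x - \sum_(0 <= j < K | Q j) a j) / d).
  rewrite divr_ge0 ?(ltW d0)// subr_ge0.
  have := @disjoint_intervals_length_le R l a Q K (fun=> x) (fun=> y) 1 a_pos.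
  rewrite big_nat1; apply.
  - by move=> _ _; exact: ltW.
  - exact: layout_disjoint lay.
  - move=> j p _ Qj hp; exists 0%N => //; move: Qj => /andP[h1 h2].
    have /(layout_mem lay)[_ /(_ j)/negP] := Ex; move: h1 h2 hp; lra.
split.
  rewrite natr_sum mulrBl mulr_suml /gap_clock.
  have -> : \sum_(0 <= j < K | l j + a j <= y) (1 - a j / d) =
      \sum_(0 <= j < K | l j + a j <= x) (1 - a j / d) +
      \sum_(0 <= j < K | Q j) (1 - a j / d).
    rewrite (bigID (fun j => l j + a j <= x)) /=.
    congr (_ + _); apply: eq_bigl => j; last by rewrite /Q ltNge andbC.
    by case: (leP (l j + a j) x) => h; rewrite ?andbF// andbT; lra.
  have -> : \sum_(0 <= j < K | Q j) (1 - a j / d) =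
      \sum_(0 <= j < K | Q j) 1 - \sum_(0 <= j < K | Q j) a j / d.
    by rewrite sumrB.
  by ring.
move=> /eqP; rewrite sum_nat_seq_eq0 => /allP h0.
by rewrite big1_seq ?subr0// => j /andP[Qj /h0]; rewrite Qj.
Qed.

Lemma gap_clock_le K (d x y : R) : 0 < d -> E x -> E y -> x <= y ->
  gap_clock K d x <= gap_clock K d y.
Proof.
move=> d0 Ex Ey; rewrite le_eqVlt => /orP[/eqP->//|xy].
have [m [t t0 [h _]]] := gap_clock_diff K d0 Ex Ey xy.
by rewrite -subr_ge0 h addr_ge0.
Qed.

Lemma gap_clock_bounds K (d x : R) : 0 < d -> E x ->
  0 <= gap_clock K d x <= K%:R + gap_tail a K / d.
Proof.
move=> d0 Ex; have T0 := total_gt0 a_pos a_summable.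
have E0 : E 0.
  apply/(layout_mem lay); rewrite lexx ltW//; split=> // j.
  by have := layout_ge0 lay j; lra.
have ET : E (total_length a).
  apply/(layout_mem lay); rewrite lexx ltW//; split=> // j.
  by have := layout_le lay j; lra.
have /(layout_mem lay)[/andP[x0 xT] _] := Ex.
have clock0 : gap_clock K d 0 = 0.
  rewrite /gap_clock mul0r add0r big1// => j h.
  by have := layout_ge0 lay j; have := a_pos j; lra.
have clockT : gap_clock K d (total_length a) = K%:R + gap_tail a K / d.
  rewrite /gap_clock (eq_bigl xpredT); last by move=> j; rewrite (layout_le lay).
  rewrite sumrB big_mkord sumr_const card_ord -mulr_suml big_mkord /gap_tail.
  by ring.
by rewrite -clock0 -clockT !gap_clock_le.
Qed.

(** The integer part of the clock splits E into at most p pieces of diameter at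
    most d, each contained in a ball of radius d centred at one of its
    points. *)
Lemma ball_coverable_of_local K (d r : R) p q : 0 < d ->
  K%:R + gap_tail a K / d < p%:R ->
  (forall x, E x -> ball_coverable r q (closed_ball x d `&` E)) ->
  ball_coverable r (p * q) E.
Proof.
move=> d0 Kp loc.
apply: (@ball_coverable_classes _ r p q E (fun x => Num.trunc (gap_clock K d x))).
  move=> x Ex; have /andP[c0 cK] := gap_clock_bounds K d0 Ex.
  by rewrite truncn_lt_nat//; exact: le_lt_trans Kp.
move=> m _; set F := E `&` _.
have [[x [Ex xm]]|nF] := pselect (exists x, F x); last first.
  by exists (fun=> 0) => x Fx; case: nF; exists x.
apply: ball_coverable_sub (leqnn q) _ (loc x Ex) => y [Ey /= ym]; split=> //.
have close u v : E u -> E v -> Num.trunc (gap_clock K d u) = m ->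
    Num.trunc (gap_clock K d v) = m -> u < v -> v - u <= d.
  move=> Eu Ev um vm uv.
  have [k [t t0 [h ht]]] := gap_clock_diff K d0 Eu Ev uv.
  have /andP[cu0 _] := gap_clock_bounds K d0 Eu.
  have /andP[cv0 _] := gap_clock_bounds K d0 Ev.
  have := truncn_itv cu0; have := truncn_itv cv0; rewrite um vm -natr1 => hv hu.
  have : k%:R < 1 :> R by lra.
  rewrite (ltr_nat R k 1) ltnS leqn0 => /eqP k0.
  move: h; rewrite k0 (ht k0) => h.
  by rewrite -[leRHS]mul1r -ler_pdivrMr//; lra.
rewrite closed_ballE// /closed_ball_ /= ler_norml.
have [xy|yx|->] := ltgtP x y; last by lra.
  by have := close x y Ex Ey xm ym xy; lra.
by have := close y x Ey Ex ym xm yx; lra.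
Qed.

(** Lower and upper count of the balls of radius s_n / 2 that cover E: at least
    2^n by [gap_tail_le_of_cover], and at most 2^(k+1) times twice the
    bound that the exponent gives for a ball of radius s_k. *)
Lemma assouad_exponent_mean_tail (alpha c rho : R) k n :
  assouad_exponent E alpha c rho -> (k <= n)%N -> mean_tail a k < rho ->
  2 ^+ n <=
  2 ^+ k * (4 * c * 2 `^ alpha) * (mean_tail a k / mean_tail a n) `^ alpha.
Proof.
move=> [c0 rho0 hE] kn krho.
have sk0 := mean_tail_gt0 a_pos a_summable k.
have sn0 := mean_tail_gt0 a_pos a_summable n.
have snk := mean_tail_antitone a_pos a_summable kn.
pose r := mean_tail a n / 2; have r0 : 0 < r by rewrite /r; lra.
pose B := c * (mean_tail a k / r) `^ alpha.
have B0 : 0 < B by rewrite mulr_gt0// powR_gt0// divr_gt0.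
have loc x : E x -> ball_coverable r (Num.trunc (2 * B))
    (closed_ball x (mean_tail a k) `&` E).
  move=> Ex; have rk : r < mean_tail a k by rewrite /r; lra.
  (* The covering number is an infimum, bounded by B; the factor 2 gives the
     strict inequality that yields an actual covering. *)
  have supB := hE r (mean_tail a k) r0 rk krho.
  have : (covering_number r (closed_ball x (mean_tail a k) `&` E) < (2 * B)%:E)%E.
    apply: (@le_lt_trans _ _ B%:E); last by rewrite lte_fin; lra.
    by apply: le_trans supB; apply: ereal_sup_ubound; exists x.
  move=> /(coverable_of_covering_number_lt r0)[m mB].
  apply: ball_coverable_sub => //.
  by rewrite truncn_ge_nat ?ltW// mulr_gt0.
have K1 : (2 ^ k).-1%:R + gap_tail a (2 ^ k).-1 / mean_tail a k
    < (2 ^ k.+1)%:R :> R.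
  have -> : gap_tail a (2 ^ k).-1 / mean_tail a k = 2 ^+ k.
    rewrite /mean_tail invfM invrK mulrA divff ?mul1r//.
    by rewrite gt_eqF// gap_tail_gt0.
  by rewrite -natrX -natrD ltr_nat expnS; have := expn_gt0 2 k; lia.
have cov := ball_coverable_of_local sk0 K1 loc.
have := gap_tail_le_of_cover r0 cov; set N := (_ * _)%N => tailN.
have nN : (2 ^ n <= N)%N.
  rewrite leqNgt; apply/negP => Nn.
  have : gap_tail a (2 ^ n).-1 <= gap_tail a N.
    by apply: gap_tail_antitone => //; lia.
  have -> : gap_tail a (2 ^ n).-1 = mean_tail a n * 2 ^+ n.
    by rewrite /mean_tail mulfVK// expf_neq0.
  move=> /le_trans /(_ tailN).
  rewrite /r (_ : 2 * _ = mean_tail a n); last by field.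
  by rewrite ler_pM2l// -natrX ler_nat leqNgt Nn.
have : (2 ^ n)%:R <= N%:R :> R by rewrite ler_nat.
rewrite natrX => /le_trans; apply; rewrite natrM.
have /andP[qB _] := truncn_itv (ltW (mulr_gt0 (ltr0n _ 2) B0)).
apply: (@le_trans _ _ ((2 ^ k.+1)%:R * (2 * B))); first by rewrite ler_wpM2l.
rewrite natrX exprS /B /r.
rewrite (_ : mean_tail a k / (mean_tail a n / 2) =
  2 * (mean_tail a k / mean_tail a n)).
  rewrite powRM//; last by rewrite divr_ge0// ltW.
  by rewrite le_eqVlt; apply/orP; left; apply/eqP; ring.
by field; rewrite gt_eqF.
Qed.

(** For negative alpha the factor (s_k / s_n)^alpha would be at most one, whereas
    2^(n-k) is unbounded. *)
Lemma assouad_exponent_ge0 (alpha c rho : R) :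
  assouad_exponent E alpha c rho -> 0 <= alpha.
Proof.
move=> hE; have [c0 rho0 _] := hE; rewrite leNgt; apply/negP => alpha0.
have [k hk] := @mean_tail_small R a a_pos a_summable (rho / 2) ltac:(lra).
have krho : mean_tail a k < rho by lra.
pose D := 4 * c * 2 `^ alpha.
have D0 : 0 < D by rewrite !mulr_gt0// powR_gt0.
pose n := (k + (Num.trunc D).+1)%N.
have kn : (k <= n)%N by exact: leq_addr.
have := assouad_exponent_mean_tail hE kn krho; rewrite -/D.
have sk0 := mean_tail_gt0 a_pos a_summable k.
have sn0 := mean_tail_gt0 a_pos a_summable n.
have ratio1 : (mean_tail a k / mean_tail a n) `^ alpha <= 1.
  have ratio0 : 0 < mean_tail a k / mean_tail a n by exact: divr_gt0.
  rewrite -[alpha]opprK powRN invf_le1 ?powR_gt0//.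
  rewrite -(powRr0 (mean_tail a k / mean_tail a n)) ler_powR; [by []| |lra].
  by rewrite ler_pdivlMr// mul1r (mean_tail_antitone a_pos a_summable kn).
rewrite leNgt => /negP; apply.
apply: (@le_lt_trans _ _ (2 ^+ k * D)).
  by rewrite ler_piMr// mulr_ge0 ?exprn_ge0// ltW.
rewrite exprD ltr_pM2l ?exprn_gt0//.
have /andP[_ h] := truncn_itv (ltW D0); apply: lt_le_trans h _.
by rewrite -natrX ler_nat ltnW// ltn_expl.
Qed.

End GapLayout.

(** * The associated Cantor set *)

Section CantorLengths.
Context {R : realType} (a : nat -> R).
Hypothesis a_pos : forall j, 0 < a j.
Hypothesis a_summable : cvgn (series a).
Hypothesis a_decr : forall j, a j.+1 <= a j.

Definition descendant_gaps (k j i : nat) : R :=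
  \sum_(l < 2 ^ i) cantor_gap a (k + i) (j * 2 ^ i + l).

(** In the binary tree of intervals, interval j of step k has heap index 2^k + j,
    and this index alone determines the gaps below it. *)
Lemma descendant_gapsE k j i :
  descendant_gaps k j i = \sum_(l < 2 ^ i) a ((2 ^ k + j) * 2 ^ i + l).-1.
Proof.
by apply: eq_bigr => l _; rewrite /cantor_gap expnD mulnDl addnA.
Qed.

Lemma descendant_gaps_ge0 k j i : 0 <= descendant_gaps k j i.
Proof. by apply: sumr_ge0 => l _; apply: ltW; exact: a_pos. Qed.

Lemma descendant_gaps_le k j k' j' i : (2 ^ k' + j' <= 2 ^ k + j)%N ->
  descendant_gaps k j i <= descendant_gaps k' j' i.
Proof.
move=> h; rewrite !descendant_gapsE; apply: ler_sum => l _.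
by apply: gap_antitone => //; have := leq_mul h (leqnn (2 ^ i)); lia.
Qed.

Lemma sum_gaps_before k :
  \sum_(l < (2 ^ k.+1).-1) a l =
  \sum_(l < (2 ^ k).-1) a l + \sum_(j < 2 ^ k) cantor_gap a k j.
Proof.
have p := expn_gt0 2 k.
have -> : ((2 ^ k.+1).-1 = (2 ^ k).-1 + 2 ^ k)%N by rewrite expnS; lia.
rewrite big_split_ord /=; congr (_ + _); apply: eq_bigr => j _.
by rewrite /cantor_gap; congr (a _); lia.
Qed.

Lemma series_root_gaps n :
  series (descendant_gaps 0 0) n = \sum_(l < (2 ^ n).-1) a l.
Proof.
elim: n => [|n IH]; first by rewrite /series /= big_geq// big_ord0.
rewrite sum_gaps_before -IH /series /= big_nat_recr//=; congr (_ + _).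
Qed.

(** Every subtree is dominated depth by depth by the whole tree, whose partial
    sums are among those of the summable series of all gaps. *)
Lemma cvg_descendant_gaps k j : cvgn (series (descendant_gaps k j)).
Proof.
apply: (@series_le_cvg _ _ (descendant_gaps 0 0)) => [i|i|i|].
- exact: descendant_gaps_ge0.
- exact: descendant_gaps_ge0.
- by apply: descendant_gaps_le; have := expn_gt0 2 k; rewrite expn0; lia.
apply: nondecreasing_is_cvgn.
  by apply: nondecreasing_series => i _ _; exact: descendant_gaps_ge0.
exists (total_length a) => _ [n _ <-].
by rewrite series_root_gaps; exact: partial_sum_le_total.
Qed.

Lemma cantor_length_ge k j n :
  series (descendant_gaps k j) n <= cantor_length a k j.
Proof.
apply: nondecreasing_cvgn_le; last exact: cvg_descendant_gaps.
by apply: nondecreasing_series => i _ _; exact: descendant_gaps_ge0.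
Qed.

Lemma cantor_length_root : cantor_length a 0 0 = total_length a.
Proof.
apply/eqP; rewrite eq_le; apply/andP; split; apply: limr_le.
- exact: cvg_descendant_gaps.
- by apply: nearW => n; rewrite series_root_gaps partial_sum_le_total.
- by [].
apply: nearW => n; apply: le_trans (cantor_length_ge 0 0 n).
have : (n <= (2 ^ n).-1)%N by have := ltn_expl n (isT : (1 < 2)%N); lia.
rewrite series_root_gaps /series /= -(big_mkord xpredT) => h.
rewrite [leRHS](big_cat_nat (leq0n _) h) /= lerDl.
by apply: sumr_ge0 => j _; exact: ltW.
Qed.

(** A larger heap index means later, hence smaller, gaps at every depth. *)
Lemma cantor_length_le k j k' j' : (2 ^ k' + j' <= 2 ^ k + j)%N ->
  cantor_length a k j <= cantor_length a k' j'.
Proof.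
move=> h; apply: lim_series_le => [||i]; try exact: cvg_descendant_gaps.
exact: descendant_gaps_le.
Qed.

(** The first term of the series is the gap removed at once; the later ones
    are distributed between the two children. *)
Lemma cantor_length_split k j : cantor_length a k j =
  cantor_gap a k j + (cantor_length a k.+1 j.*2 + cantor_length a k.+1 j.*2.+1).
Proof.
have step i : descendant_gaps k j i.+1 =
    descendant_gaps k.+1 j.*2 i + descendant_gaps k.+1 j.*2.+1 i.
  rewrite !descendant_gapsE; have -> : (2 ^ i.+1 = 2 ^ i + 2 ^ i)%N.
    by rewrite expnS mul2n addnn.
  rewrite big_split_ord /=; congr (_ + _); apply: eq_bigr => l _; congr (a _.-1);
    by rewrite expnS -muln2; ring.
apply: cvg_lim => //; rewrite -cvg_shiftS.
have -> : [sequence series (descendant_gaps k j) n.+1]_n =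
    (fun n => cantor_gap a k j + (series (descendant_gaps k.+1 j.*2) n +
      series (descendant_gaps k.+1 j.*2.+1) n)).
  apply/funext => n; rewrite /series /= big_nat_recl//; congr (_ + _).
    by rewrite /descendant_gaps big_ord1 addn0 muln1 addn0.
  by rewrite -big_split; apply: eq_bigr => i _; exact: step.
by apply: cvgD; [exact: cvg_cst|apply: cvgD; exact: cvg_descendant_gaps].
Qed.

Lemma sum_even_odd (F : nat -> R) n :
  \sum_(j < 2 * n) F j = \sum_(j < n) (F j.*2 + F j.*2.+1).
Proof.
elim: n => [|n IH]; first by rewrite muln0 !big_ord0.
have -> : (2 * n.+1 = (2 * n).+2)%N by lia.
by rewrite 2!big_ord_recr IH big_ord_recr /= -addrA mul2n.
Qed.

Lemma sum_cantor_length k :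
  \sum_(j < 2 ^ k) cantor_length a k j = gap_tail a (2 ^ k).-1.
Proof.
elim: k => [|k IH].
  by rewrite big_ord1 cantor_length_root /gap_tail big_ord0 subr0.
rewrite expnS sum_even_odd -expnS /gap_tail sum_gaps_before.
move: IH; under eq_bigr do rewrite cantor_length_split.
rewrite big_split /= /gap_tail => IH; lra.
Qed.

(** Any heap index of step k + 1 exceeds all those of step k, so the length is at
    most each of the lengths whose mean is s_k. *)
Lemma cantor_length_le_mean k j : cantor_length a k.+1 j <= mean_tail a k.
Proof.
rewrite /mean_tail ler_pdivlMr ?exprn_gt0// -sum_cantor_length.
rewrite -natrX mulr_natr -[X in _ *+ X]card_ord -sumr_const.
apply: ler_sum => i _.
apply: cantor_length_le; have := expnS 2 k; have := ltn_ord i; lia.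
Qed.

Lemma mean_le_cantor_length k j : (j < 2 ^ k)%N ->
  mean_tail a k.+1 <= cantor_length a k j.
Proof.
move=> jk; rewrite /mean_tail ler_pdivrMr ?exprn_gt0// -sum_cantor_length.
rewrite -natrX mulr_natr -[X in _ *+ X]card_ord -sumr_const.
apply: ler_sum => i _.
apply: cantor_length_le; have := expnS 2 k; lia.
Qed.

Definition cantor_right (k j : nat) : R :=
  cantor_left a k j + cantor_length a k j.

Lemma cantor_left_even k j : cantor_left a k.+1 j.*2 = cantor_left a k j.
Proof. by rewrite /= odd_double addr0 doubleK. Qed.

Lemma cantor_left_odd k j : cantor_left a k.+1 j.*2.+1 =
  cantor_right k.+1 j.*2 + cantor_gap a k j.
Proof.
rewrite /cantor_right cantor_left_even /= odd_double /= uphalf_double.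
by rewrite -addrA.
Qed.

Lemma cantor_right_odd k j : cantor_right k.+1 j.*2.+1 = cantor_right k j.
Proof.
rewrite {1}/cantor_right cantor_left_odd /cantor_right cantor_left_even.
rewrite (cantor_length_split k j); ring.
Qed.

Lemma cantor_length_ge0 k j : 0 <= cantor_length a k j.
Proof. by have := cantor_length_ge k j 0; rewrite /series /= big_geq. Qed.

Lemma even_or_odd j : j = j./2.*2 \/ j = j./2.*2.+1.
Proof. by have := odd_double_half j; case: (odd j) => h; [right|left]; lia. Qed.

Lemma cantor_right_le_left k i j : (i < j < 2 ^ k)%N ->
  cantor_right k i <= cantor_left a k j.
Proof.
suff adj m : (m.+1 < 2 ^ k)%N -> cantor_right k m <= cantor_left a k m.+1.
  elim: j => // j IH /andP[]; rewrite ltnS leq_eqVlt => /orP[/eqP->|ij] jk.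
    exact: adj.
  apply: le_trans (adj j jk); apply: le_trans (IH _) _; first by rewrite ij ltnW.
  by rewrite lerDl cantor_length_ge0.
elim: k m => [|k IH] m; first by rewrite expn0 ltnS.
have [->|->] := even_or_odd m => h.
  by rewrite cantor_left_odd lerDl; apply: ltW; exact: a_pos.
rewrite cantor_right_odd -doubleS cantor_left_even; apply: IH.
by move: h; rewrite expnS; lia.
Qed.

Lemma cantor_child_sub k j :
  cantor_left a k j./2 <= cantor_left a k.+1 j /\
  cantor_right k.+1 j <= cantor_right k j./2.
Proof.
move: (j./2) (even_or_odd j) => i jE.
have g0 : 0 < cantor_gap a k i by exact: a_pos.
have := cantor_length_ge0 k.+1 i.*2; have := cantor_length_ge0 k.+1 i.*2.+1.
have := cantor_right_odd k i; have := cantor_left_odd k i.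
have := cantor_left_even k i.
by case: jE => ->; rewrite /cantor_right => *; split; lra.
Qed.

Lemma cantor_interval_nested k i j x :
  cantor_left a (k + i) j <= x <= cantor_right (k + i) j ->
  cantor_left a k (j %/ 2 ^ i) <= x <= cantor_right k (j %/ 2 ^ i).
Proof.
elim: i j => [|i IH] j; first by rewrite addn0 expn0 divn1.
rewrite addnS expnS divnMA divn2 => h; apply: IH.
have [hl hr] := cantor_child_sub (k + i) j; lra.
Qed.

Lemma cantor_set_mem k x : cantor_set a x ->
  exists2 j, (j < 2 ^ k.+1)%N & cantor_left a k.+1 j <= x <= cantor_right k.+1 j.
Proof.
move=> /(_ k.+1 isT)[j jk]; rewrite /cantor_interval /= in_itv/= => h.
by exists j.
Qed.

(** Intervals of step u that are not neighbours are more than s apart, as a whole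
    interval longer than s lies between them.  So the points of the ball are in
    the interval of x or in one of its two neighbours, which have
    3 * 2^(m+1) descendants m + 1 steps later, each inside the ball of radius r
    centred at its left end. *)
Lemma cantor_set_local_cover u m x (r s : R) :
  0 < s -> (forall j, (j < 2 ^ u)%N -> s < cantor_length a u j) ->
  (forall j, cantor_length a (u + m).+1 j <= r) ->
  cantor_set a x ->
  ball_coverable r (3 * 2 ^ m.+1) (closed_ball x s `&` cantor_set a).
Proof.
move=> s0 longu shortn Cx.
have near y : closed_ball x s y -> - s <= x - y <= s.
  by rewrite closed_ballE// /closed_ball_ /= ler_norml.
have ancestor z : cantor_set a z -> exists j, [/\ (j %/ 2 ^ m.+1 < 2 ^ u)%N,
    cantor_left a (u + m).+1 j <= z <= cantor_right (u + m).+1 j &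
    cantor_left a u (j %/ 2 ^ m.+1) <= z <= cantor_right u (j %/ 2 ^ m.+1)].
  move=> /(cantor_set_mem (u + m))[j jn zj]; exists j; split=> //.
    by rewrite ltn_divLR ?expn_gt0// -expnD addnS.
  by apply: cantor_interval_nested; rewrite addnS.
have far p q v w : (p.+1 < q < 2 ^ u)%N -> v <= cantor_right u p ->
    cantor_left a u q <= w -> v + s < w.
  move=> /andP[pq qu] vp qw.
  have h1 : cantor_right u p <= cantor_left a u p.+1.
    by apply: cantor_right_le_left; rewrite ltnSn (ltn_trans pq).
  have h2 : cantor_right u p.+1 <= cantor_left a u q.
    by apply: cantor_right_le_left; rewrite pq.
  have := longu _ (ltn_trans pq qu); move: h2; rewrite /cantor_right => h2 h3.
  by move: vp h1; rewrite /cantor_right => vp h1; lra.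
have [i [iu _ /andP[xl xr]]] := ancestor x Cx.
set i0 := (i %/ 2 ^ m.+1)%N in iu xl xr.
(* When i0 = 0 there is no left neighbour, and truncation starts the
   enumeration at interval 0; the range of three intervals still suffices. *)
exists (fun t => cantor_left a (u + m).+1 (i0.-1 * 2 ^ m.+1 + t)).
move=> y [/near yx Cy].
have [j [ju yj /andP[yl yr]]] := ancestor y Cy.
have d0 : (0 < 2 ^ m.+1)%N by rewrite expn_gt0.
have := leq_trunc_div j (2 ^ m.+1); have := ltn_ceil j d0.
move: ju yl yr; set j0 := (j %/ 2 ^ m.+1)%N => ju yl yr jj0 j0j.
have ji : (j0 <= i0.+1)%N.
  rewrite leqNgt; apply/negP => h.
  have : x + s < y by apply: (far i0 j0) => //; rewrite h.
  by lra.
have ij : (i0 <= j0.+1)%N.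
  rewrite leqNgt; apply/negP => h.
  have : y + s < x by apply: (far j0 i0) => //; rewrite h.
  by lra.
have lej : (i0.-1 * 2 ^ m.+1 <= j)%N.
  by apply: leq_trans j0j; rewrite leq_mul2r; apply/orP; right; clear -ij ji; lia.
exists (j - i0.-1 * 2 ^ m.+1)%N.
  rewrite ltn_subLR// -mulnDl; apply: leq_trans jj0 _.
  by rewrite leq_mul2r; apply/orP; right; clear -ij ji; lia.
rewrite (subnKC lej) ler_norml; have := shortn j; move: yj.
by rewrite /cantor_right; lra.
Qed.

End CantorLengths.

(** * Comparison of the dimensions *)

Theorem theorem8 (R : realType) (a : nat -> R)
    (a_pos : forall j, 0 < a j)
    (a_summable : cvgn (series a))
    (a_decr : forall j, a j.+1 <= a j)
    (E : set R) (hE : complementary_set a E) :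
  (assouad_dim (cantor_set a) <= assouad_dim E)%E.
Proof.
have [l lay] := complementary_set_layout a_pos hE.
apply: ereal_inf_le_tmp => _ [alpha [c [rho expE]] <-]; exists alpha => //.
have alpha0 := assouad_exponent_ge0 a_pos a_summable a_decr lay expE.
have mean n k := assouad_exponent_mean_tail a_pos a_summable a_decr lay expE
  (k := k) (n := n).
have [c0 rho0 _] := expE.
set D := 4 * c * 2 `^ alpha in mean.
have D0 : 0 < D by rewrite !mulr_gt0// powR_gt0.
(* The three intervals of step u have 3 * 2^(w+3-u) descendants.  For w = u this
   is 24; otherwise it is 48 * 2^((w+1)-(u+2)), which the bound for E controls. *)
exists (48 * D + 24), (Num.min rho (mean_tail a 1)); split.
- by lra.
- by rewrite lt_min rho0 mean_tail_gt0.
move=> r s r0 rs; rewrite lt_min => /andP[srho s1].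
have s0 := lt_trans r0 rs.
have [u /andP[us su]] := mean_tail_bracket a_pos a_summable s0 s1.
have [w /andP[wr rw]] := mean_tail_bracket a_pos a_summable r0 (lt_trans rs s1).
have uw : (u <= w)%N.
  rewrite leqNgt; apply/negP => wu.
  by have := mean_tail_antitone a_pos a_summable (wu : (w.+2 <= u.+1)%N); lra.
have sr1 : 1 <= s / r by rewrite ler_pdivlMr// mul1r ltW.
have pow1 : 1 <= (s / r) `^ alpha.
  by rewrite -(powRr0 (s / r)) ler_powR.
apply: ge_ereal_sup => _ [x Cx <-].
(* Step w + 3 is the first at which every interval is known to have length at
   most r. *)
have cov : ball_coverable r (3 * 2 ^ (w - u).+3)
    (closed_ball x s `&` cantor_set a).
  apply: (@cantor_set_local_cover R a a_pos a_summable a_decr u) => //.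
    move=> j ju; apply: lt_le_trans su _; exact: mean_le_cantor_length.
  rewrite !addnS subnKC//.
  move=> j; apply: le_trans wr; exact: cantor_length_le_mean.
apply: le_trans (covering_number_le r0 cov) _; rewrite lee_fin natrM natrX.
move: uw; rewrite leq_eqVlt => /orP[/eqP->|uw].
  have DX : 0 <= D * (s / r) `^ alpha by apply: mulr_ge0; lra.
  by rewrite subnn; lra.
have su0 := mean_tail_gt0 a_pos a_summable u.+2.
have sw0 := mean_tail_gt0 a_pos a_summable w.+1.
have ratio_le : mean_tail a u.+2 / mean_tail a w.+1 <= s / r.
  apply: ler_pM => //; rewrite ?invr_ge0 ?(ltW su0) ?(ltW sw0)//.
  by rewrite lef_pV2 ?posrE// ltW.
have pow_le : (mean_tail a u.+2 / mean_tail a w.+1) `^ alpha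
    <= (s / r) `^ alpha.
  apply: ge0_ler_powR => //; rewrite nnegrE;
    by apply: divr_ge0; exact: ltW.
have pow_split : 2 ^+ w.+1 = 2 ^+ u.+2 * 2 ^+ (w - u.+1) :> R.
  by rewrite -exprD addSn subnKC.
have := mean w.+1 u.+2 uw (le_lt_trans us srho).
rewrite pow_split -mulrA ler_pM2l ?exprn_gt0// => h.
have -> : ((w - u).+3 = 4 + (w - u.+1))%N by rewrite -(subnSK uw).
rewrite exprD; have := ler_wpM2l (ltW D0) pow_le; lra.
Qed.
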